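(* Let $n\ge 2$ be an integer and let $(n_1,n_2)\times[k_1,k_2]$ be a partition of $n$ into two different parts, i.e. integers $n_1>n_2\ge1$, $k_1,k_2\ge1$ with $k_1n_1+k_2n_2=n$. Then there exist integers $e\ge1$, $N>s\ge1$ with $eN=n$ such that $(N,s)\times[e,0]$ is an ancestor of $(n_1,n_2)\times[k_1,k_2]$ under the extended Farey map; that is, every such partition can be obtained from the dynamics of the extended Farey map.
   Context: For integers $a_1\ge a_2\ge1$ and $c_1,c_2\ge0$, $(a_1,a_2)\times[c_1,c_2]$ denotes the partition of $c_1a_1+c_2a_2$ with $c_1$ parts $a_1$ and $c_2$ parts $a_2$. Define $\tilde F_0((a_1,a_2)\times[c_1,c_2])=(a_2,a_1-a_2)\times[c_1+c_2,c_1]$ and $\tilde F_1((a_1,a_2)\times[c_1,c_2])=(a_1-a_2,a_2)\times[c_1,c_1+c_2]$. The extended Farey map $\tilde F$ applies $\tilde F_0$ when $a_2\ge a_1-a_2$ and $\tilde F_1$ when $a_1-a_2\ge a_2$ (either one may be applied when $a_1=2a_2$). Both preserve the partitioned number. A partition $\lambda$ is an ancestor of $\mu$ (and $\mu$ a descendant of $\lambda$) if $\mu$ is obtained from $\lambda$ by finitely many applications of $\tilde F$. *)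

(* Defs.v *)
From Stdlib Require Import Relation_Operators.
From mathcomp Require Import all_boot.

Set Implicit Arguments.
Unset Strict Implicit.
Unset Printing Implicit Defensive.

(** [Part2 a1 a2 c1 c2] is the symbol (a1, a2) x [c1, c2]: [c1] parts equal to
    [a1] and [c2] parts equal to [a2].  It records all four numbers and not only
    the multiset of parts: a part with multiplicity 0 still matters for the
    dynamics. *)
Record part2 := Part2 { part_1 : nat; part_2 : nat; mult_1 : nat; mult_2 : nat }.

Definition part2_wf (p : part2) : Prop :=
  (1 <= part_2 p) /\ (part_2 p <= part_1 p).

Definition partitioned_number (p : part2) : nat :=
  mult_1 p * part_1 p + mult_2 p * part_2 p.

Definition farey0 (p : part2) : part2 :=
  let: Part2 a1 a2 c1 c2 := p in Part2 a2 (a1 - a2) (c1 + c2) c1.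

Definition farey1 (p : part2) : part2 :=
  let: Part2 a1 a2 c1 c2 := p in Part2 (a1 - a2) a2 c1 (c1 + c2).

(** The extended Farey map is a relation because both branches are allowed when
    a1 = 2 a2.  Truncated subtraction is the true one as [part2_wf p] holds.
    From a symbol with a1 = a2 the only image has second part 0; it is not
    [part2_wf], so the dynamics stops there. *)
Definition farey_step (p q : part2) : Prop :=
  part2_wf p /\
  ((part_1 p - part_2 p <= part_2 p /\ q = farey0 p) \/
   (part_2 p <= part_1 p - part_2 p /\ q = farey1 p)).

Definition ancestor (p q : part2) : Prop := clos_refl_trans part2 farey_step p q.

Lemma partitioned_number_farey_step (p q : part2) :
  farey_step p q -> partitioned_number q = partitioned_number p.
Proof.
case: p => a1 a2 c1 c2 [[/= _ le21]] [] [_ ->]; rewrite /partitioned_number /=.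
- by rewrite mulnDl mulnBr addnAC subnKC // leq_mul2l le21 orbT.
- by rewrite mulnBr mulnDl addnA subnK // leq_mul2l le21 orbT.
Qed.

(* Main.v *)
(** Each branch of the Farey map has an inverse, fixed by its action on the
    multiplicities: [d1, d2] comes from [d2, d1 - d2] under the first branch if
    d2 <= d1, and from [d1, d2 - d1] under the second if d1 <= d2.  Going back
    in time is thus the subtractive Euclidean algorithm on the multiplicities,
    which ends at [e, 0] with e their gcd. *)
Require Import Defs.
From Stdlib Require Import Relation_Operators.
From mathcomp Require Import all_boot.

(** The parts [b1 + b2] and [b1] differ by [b2], so the guard of the first branch reduces to
    [b2 <= b1]. *)
Lemma farey_step_preimage0 (b1 b2 d1 d2 : nat) :
  1 <= b2 <= b1 -> d2 <= d1 ->
  farey_step (Part2 (b1 + b2) b1 d2 (d1 - d2)) (Part2 b1 b2 d1 d2).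
Proof.
move=> /andP[b2_gt0 le_b] le_d; split.
  by split; rewrite /= ?leq_addr ?(leq_trans b2_gt0).
by left; rewrite /= addKn subnKC.
Qed.

Lemma farey_step_preimage1 (b1 b2 d1 d2 : nat) :
  1 <= b2 <= b1 -> d1 <= d2 ->
  farey_step (Part2 (b1 + b2) b2 d1 (d2 - d1)) (Part2 b1 b2 d1 d2).
Proof.
move=> /andP[b2_gt0 le_b] le_d; split; first by split; rewrite /= ?leq_addl.
by right; rewrite /= addnK subnKC.
Qed.

Lemma ancestor_step (p q r : part2) :
  ancestor p q -> farey_step q r -> ancestor p r.
Proof. by move=> pq qr; apply: rt_trans pq _; apply: rt_step. Qed.

Lemma partitioned_number_ancestor (p q : part2) :
  ancestor p q -> partitioned_number q = partitioned_number p.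
Proof.
by elim=> [x y /partitioned_number_farey_step | | x y z _ -> _ ->].
Qed.

(** Strong induction on [d1 + d2]: one step back replaces this sum by [maxn d1 d2], which is smaller
    as both are positive. *)
Lemma ancestor_mult_2_eq0 (b1 b2 d1 d2 : nat) :
  1 <= b2 <= b1 -> 1 <= d1 -> 1 <= d2 ->
  exists e N s : nat,
    [/\ 1 <= e, s < N, 1 <= s & ancestor (Part2 N s e 0) (Part2 b1 b2 d1 d2)].
Proof.
have [m] := ubnP (d1 + d2); elim: m => // m IHm in b1 b2 d1 d2 *.
rewrite ltnS => le_m b_ok d1_gt0 d2_gt0; have /andP[b2_gt0 le_b] := b_ok.
have b1_gt0 : 0 < b1 by apply: leq_trans le_b.
case: (ltngtP d1 d2) => [lt_d | lt_d | eq_d].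
- have le_d := ltnW lt_d.
  have [|||| e [N [s [e_gt0 ltsN s_gt0 anc]]]] :=
    IHm (b1 + b2) b2 d1 (d2 - d1); rewrite ?subn_gt0 ?b2_gt0 ?leq_addl //.
    by rewrite subnKC // (leq_trans _ le_m) // -add1n leq_add2r.
  exists e, N, s; split=> //.
  by apply: ancestor_step anc _; apply: farey_step_preimage1.
- have le_d := ltnW lt_d.
  have [|||| e [N [s [e_gt0 ltsN s_gt0 anc]]]] :=
    IHm (b1 + b2) b1 d2 (d1 - d2); rewrite ?subn_gt0 ?b1_gt0 ?leq_addr //.
    by rewrite subnKC // (leq_trans _ le_m) // -addn1 leq_add2l.
  exists e, N, s; split=> //.
  by apply: ancestor_step anc _; apply: farey_step_preimage0.
(* Equal multiplicities end the descent: one more step back under the second branch leaves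
   [[d1, 0]], and [b2 < b1 + b2] as [b1] is positive. *)
exists d1, (b1 + b2), b2; split=> //; first by rewrite -add1n leq_add2r.
apply: rt_step; rewrite -[0](subnn d1) {2}eq_d.
by apply: farey_step_preimage1; rewrite ?eq_d.
Qed.

Theorem theorem4p19 (n n1 n2 k1 k2 : nat) :
  2 <= n ->
  n2 < n1 -> 1 <= n2 -> 1 <= k1 -> 1 <= k2 ->
  partitioned_number (Part2 n1 n2 k1 k2) = n ->
  exists e N s : nat,
    [/\ 1 <= e, s < N, 1 <= s, e * N = n &
        ancestor (Part2 N s e 0) (Part2 n1 n2 k1 k2)].
Proof.
move=> _ lt_n n2_gt0 k1_gt0 k2_gt0 <-.
have n_ok : 1 <= n2 <= n1 by rewrite n2_gt0 ltnW.
have [e [N [s [e_gt0 ltsN s_gt0 anc]]]] :=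
  ancestor_mult_2_eq0 _ _ _ _ n_ok k1_gt0 k2_gt0.
exists e, N, s; split=> //.
(* Invariance gives [e * N + 0 * s = n]. *)
by rewrite (partitioned_number_ancestor _ _ anc) /partitioned_number /= addn0.
Qed.
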